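(* Let $T\in(0,\infty)$, and let $A:U_T\to\mathcal M^{n\times n}_{\rm sym}$ and $b:U_T\to\mathbb R^n$ be given functions. Assume there are constants $c_0>0$, $M_1>0$ and $M_2\ge 0$ such that for all $(x,t)\in U_T$ and all $\xi\in\mathbb R^n$, $$\xi^{\rm T}A(x,t)\xi\ge c_0|\xi|^2,\qquad {\rm Tr}(A(x,t))\le M_1,\qquad |b(x,t)|\le M_2 .$$ Let $x_0\in\mathbb R^n\setminus\bar U$, $r_0=r_*(x_0)$, $R=R_*(x_0)$, and set $$\beta_*=\frac{M_1+M_2R}{2c_0},\qquad \beta=\max\left\{\beta_*,\frac{R^2}{4c_0T}\right\},\qquad \eta_*=1-(r_0/R)^{2\beta}.$$ Assume that $4c_0\beta_*T=R^2$ (so that $\beta=\beta_*$). Let $w\in C(\overline{U_T})\cap C^{2,1}_{x,t}(U_T)$ and suppose there is a function $F\in C([0,T],[0,\infty))$ such that $\widetilde Lw(x,t)\le F(t)$ for all $(x,t)\in U_T$. Then $$\max_{x\in\bar U}w^+(x,T)\le \eta_*\max_{x\in\bar U}w^+(x,0)+\max_{(x,t)\in\Gamma\times[0,T]}w^+(x,t)+\int_0^TF(t)\,{\rm d}t .$$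
   Context: $n\ge1$ is fixed; $U$ is a non-empty, open, bounded subset of $\mathbb R^n$ with boundary $\Gamma$ and closure $\bar U$. $\mathcal M^{n\times n}_{\rm sym}$ is the set of real symmetric $n\times n$ matrices. $U_T=U\times(0,T]$ and $\overline{U_T}=\bar U\times[0,T]$. $C^{2,1}_{x,t}(U\times I)$, for an interval $I$, is the class of continuous functions $u(x,t)$ on $U\times I$ with continuous partial derivatives $\partial u/\partial t$, $\partial u/\partial x_i$, $\partial^2u/\partial x_i\partial x_j$ for $i,j=1,\dots,n$. For matrices, $\langle A,B\rangle={\rm Tr}(A^{\rm T}B)$; $D^2w$ is the Hessian matrix in $x$ and $\nabla w$ the gradient in $x$. $w^+=\max\{0,w\}$. For $y\notin\bar U$: $r_*(y)=\min\{|x-y|:x\in\bar U\}$ and $R_*(y)=\max\{|x-y|:x\in\bar U\}$. The linear operator $\widetilde L$ is $\widetilde Lw=w_t-\langle A(x,t),D^2w\rangle+b(x,t)\cdot\nabla w$. *)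

(* Defs.v *)
From HB Require Import structures.
From mathcomp Require Import all_boot all_order all_algebra.
From mathcomp Require Import all_classical all_reals all_analysis.
Set Implicit Arguments.
Unset Strict Implicit.
Unset Printing Implicit Defensive.
Import Order.TTheory GRing.Theory Num.Theory.
Import numFieldNormedType.Exports.

Local Open Scope classical_set_scope.
Local Open Scope ring_scope.

(* R^n is the type 'rV[R]_n of row vectors.  Its library norm is the sup norm:
   it induces the usual topology and bounded sets, but Euclidean lengths have
   to be defined. *)
Definition dotv {R : realType} {n : nat} (x y : 'rV[R]_n) : R :=
  \sum_(i < n) x 0 i * y 0 i.

Definition enorm {R : realType} {n : nat} (x : 'rV[R]_n) : R :=
  Num.sqrt (dotv x x).

Definition dotmat {R : realType} {n : nat} (A B : 'M[R]_n) : R :=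
  \tr (A^T *m B).

Definition boundary {T : topologicalType} (U : set T) : set T :=
  closure U `\` interior U.

(* The default value of [get] is returned only if the extremum is not
   attained, see max_onP and min_onP. *)
Definition max_on {R : realType} {T : Type} (D : set T) (f : T -> R) : R :=
  get [set m | (f @` D) m /\ ubound (f @` D) m].

Definition min_on {R : realType} {T : Type} (D : set T) (f : T -> R) : R :=
  get [set m | (f @` D) m /\ lbound (f @` D) m].

Lemma max_onP (R : realType) (T : topologicalType) (D : set T) (f : T -> R) :
  D !=set0 -> compact D -> {within D, continuous f} ->
  (exists2 c, D c & f c = max_on D f) /\ (forall x, D x -> f x <= max_on D f).
Proof.
move=> D0 cD cf; have [c cinD fmax] := compact_EVT_max D0 cD cf.
have H : [set m | (f @` D) m /\ ubound (f @` D) m] (max_on D f).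
  apply: getPex; exists (f c); split; first by exists c => //; exact/set_mem.
  by move=> _ [x Dx <-]; apply: fmax; exact/mem_set.
case: H => -[x Dx fx] ub; split; first by exists x.
by move=> y Dy; apply: ub; exists y.
Qed.

Lemma min_onP (R : realType) (T : topologicalType) (D : set T) (f : T -> R) :
  D !=set0 -> compact D -> {within D, continuous f} ->
  (exists2 c, D c & f c = min_on D f) /\ (forall x, D x -> min_on D f <= f x).
Proof.
move=> D0 cD cf; have [c cinD fmin] := compact_EVT_min D0 cD cf.
have H : [set m | (f @` D) m /\ lbound (f @` D) m] (min_on D f).
  apply: getPex; exists (f c); split; first by exists c => //; exact/set_mem.
  by move=> _ [x Dx <-]; apply: fmin; exact/mem_set.
case: H => -[x Dx fx] lb; split; first by exists x.
by move=> y Dy; apply: lb; exists y.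
Qed.

Definition r_star {R : realType} {n : nat} (U : set 'rV[R]_n) (y : 'rV[R]_n) :
  R := min_on (closure U) (fun x => enorm (x - y)).

Definition R_star {R : realType} {n : nat} (U : set 'rV[R]_n) (y : 'rV[R]_n) :
  R := max_on (closure U) (fun x => enorm (x - y)).

Definition pospart {R : realType} {X : Type} (w : X -> R) (p : X) : R :=
  Num.max 0 (w p).

Section SpaceTimeDerivatives.
Context {R : realType} {n : nat}.
Implicit Types (u : 'rV[R]_n * R -> R) (p : 'rV[R]_n * R) (I : set R).

(* Functions on a subset of R^n * R are represented by total functions whose
   values off that subset are irrelevant.  The time derivative is therefore
   taken along the times s in I only; it is one-sided at an endpoint of I
   belonging to I. *)
Definition time_quot u p (s : R) : R := (u (p.1, s) - u (p.1, p.2)) / (s - p.2).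

Definition derivable_t I u p : Prop :=
  cvg (time_quot u p s @[s --> within I p.2^']).

Definition deriv_t I u p : R :=
  lim (time_quot u p s @[s --> within I p.2^']).

Definition derivable_x (i : 'I_n) u p : Prop :=
  derivable (fun y => u (y, p.2)) p.1 (delta_mx 0 i).

Definition deriv_x (i : 'I_n) u p : R :=
  'D_(delta_mx 0 i) (fun y => u (y, p.2)) p.1.

Definition grad_x u p : 'rV[R]_n := \row_(i < n) deriv_x i u p.

Definition hess_x u p : 'M[R]_n :=
  \matrix_(i < n, j < n) deriv_x i (deriv_x j u) p.

Definition C21 (U : set 'rV[R]_n) I u : Prop :=
  [/\ {within U `*` I, continuous u},
      (forall p, (U `*` I) p -> derivable_t I u p) /\
        {within U `*` I, continuous (deriv_t I u)},
      (forall i, (forall p, (U `*` I) p -> derivable_x i u p) /\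
        {within U `*` I, continuous (deriv_x i u)})
    & (forall i j,
        (forall p, (U `*` I) p -> derivable_x i (deriv_x j u) p) /\
        {within U `*` I, continuous (deriv_x i (deriv_x j u))})].

Definition Ltilde I (A : 'rV[R]_n * R -> 'M[R]_n) (b : 'rV[R]_n * R -> 'rV[R]_n)
    u p : R :=
  deriv_t I u p - dotmat (A p) (hess_x u p) + dotv (b p) (grad_x u p).

End SpaceTimeDerivatives.

(* Main.v *)
Require Import Defs.
From HB Require Import structures.
From mathcomp Require Import all_boot all_order all_algebra.
From mathcomp Require Import all_classical all_reals all_analysis.
From mathcomp Require Import ring lra.
Import Order.TTheory GRing.Theory Num.Theory.
Import numFieldNormedType.Exports.

Local Open Scope classical_set_scope.
Local Open Scope ring_scope.

(* Put [phi (x, t) = t^(-beta) exp (-|x - x0|^2 / (4 c0 t))].  The choice of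
   [beta = (M1 + M2 R) / (2 c0)] makes [phi] a subsolution of [Ltilde] on
   [|x - x0| <= R].  It is bounded by [K = (4 c0 beta / (e r0^2))^beta], vanishes
   at [t = 0], and is at least [(r0 / R)^(2 beta) K] at the time
   [T = R^2 / (4 c0 beta)].  With [M0] and [N] the maxima of [w^+] at time [0]
   and on the lateral boundary, the maximum principle gives
   [w <= N + M0 (1 - phi / K) + \int_0^t F]; take [t = T]. *)

(** * Linear algebra *)

(** The bounds on [A] and [b] can be attained, and then [phi] is only an exact solution, so an
    interior maximum of [w + m * phi - \int F] is not contradictory by itself. The extra term
    [- e * s] makes the inequality strict there, and [e] is arbitrary. Two features of such a
    maximum shape the proof. It may occur at the final time, where only earlier times are available,
    so time enters through one-sided bounds on increments. Moreover [C21] provides continuous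
    partial derivatives rather than a second-order Taylor expansion, so the maximum is tested on
    straight lines, which controls the quadratic form of the Hessian; pivoting, instead of
    diagonalization, then gives the sign of its pairing with [A]. The maximum exists by compactness
    of the closed cylinder. This requires continuity of [phi] down to [t = 0], which rests on
    [|x - x0| >= r0 > 0] on [closure U]. *)

Section dotv_theory.
Context {R : realType} {n : nat}.
Implicit Types x y z : 'rV[R]_n.

Lemma dotvE x y : dotv x y = (x *m y^T) 0 0.
Proof. by rewrite mxE; apply: eq_bigr => i _; rewrite mxE. Qed.

Lemma dotvC x y : dotv x y = dotv y x.
Proof. by apply: eq_bigr => i _; rewrite mulrC. Qed.

Lemma dotvDl x y z : dotv (x + y) z = dotv x z + dotv y z.
Proof. by rewrite !dotvE mulmxDl mxE. Qed.

Lemma dotvZl (a : R) x y : dotv (a *: x) y = a * dotv x y.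
Proof. by rewrite !dotvE -scalemxAl mxE. Qed.

Lemma dotvDr x y z : dotv x (y + z) = dotv x y + dotv x z.
Proof. by rewrite dotvC dotvDl !(dotvC x). Qed.

Lemma dotvZr (a : R) x y : dotv x (a *: y) = a * dotv x y.
Proof. by rewrite dotvC dotvZl dotvC. Qed.

Lemma dotv_ge0 x : 0 <= dotv x x.
Proof. by apply: sumr_ge0 => i _; rewrite -expr2 sqr_ge0. Qed.

Lemma dotv_eq0 x : dotv x x = 0 -> x = 0.
Proof.
move=> /eqP; rewrite psumr_eq0 => [/allP x0|i _]; last by rewrite -expr2 sqr_ge0.
apply/rowP => i; have := x0 i (mem_index_enum _); rewrite mxE -expr2 sqrf_eq0.
by move/eqP.
Qed.

Lemma enorm_ge0 x : 0 <= enorm x. Proof. exact: sqrtr_ge0. Qed.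

Lemma enormE x : enorm x ^+ 2 = dotv x x.
Proof. by rewrite sqr_sqrtr// dotv_ge0. Qed.

Lemma dotv_le x y : `|dotv x y| <= enorm x * enorm y.
Proof.
rewrite -(@ler_pXn2r _ 2)// ?nnegrE ?mulr_ge0 ?enorm_ge0//.
rewrite exprMn !enormE real_normK ?num_real//.
set a := dotv y y; set b := dotv x y.
(* The squared length of this vector is [a * (a * dotv x x - b ^+ 2)]. *)
have := dotv_ge0 (a *: x - b *: y).
rewrite -scaleNr !(dotvDl, dotvDr, dotvZl, dotvZr) (dotvC y x) -/a -/b => h.
have [a0|a0] := eqVneq a 0.
  by rewrite /b (dotv_eq0 _ a0) dotvE trmx0 mulmx0 mxE expr0n/= a0 mulr0.
have a_gt0 : 0 < a by rewrite lt_def a0 dotv_ge0.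
rewrite -(ler_pM2l a_gt0) -subr_ge0; apply: le_trans h _.
by rewrite le_eqVlt; apply/orP; left; apply/eqP; ring.
Qed.

Lemma dotv_continuous y : continuous (fun x : 'rV[R]_n => dotv (x - y) (x - y)).
Proof.
move=> x; rewrite /dotv.
rewrite /continuous_at.
apply: (@cvg_big R 'I_n +%R 0 xpredT (@add_continuous R^o) _ (nbhs x) _
  (fun (i : 'I_n) (z : 'rV[R]_n) => (z - y) 0 i * (z - y) 0 i)
  (fun i => (x - y) 0 i * (x - y) 0 i)).
move=> i _; have cxi : (fun z : 'rV[R]_n => (z - y) 0 i) z @[z --> x] --> (x - y) 0 i.
  have -> : (fun z : 'rV[R]_n => (z - y) 0 i) = (fun z => z 0 i - y 0 i).
    by apply/funext => z; rewrite !mxE.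
  have -> : (x - y) 0 i = x 0 i - y 0 i by rewrite !mxE.
  exact: (cvgB (@coord_continuous R 1 n 0 i x) (cvg_cst _)).
exact: cvgM.
Qed.

Lemma enorm_continuous y : continuous (fun x : 'rV[R]_n => enorm (x - y)).
Proof.
by move=> x; exact: (continuous_comp (dotv_continuous y x) (@sqrt_continuous R _)).
Qed.
End dotv_theory.

(* Pivoting on [a = A 0 0] with first row [v] gives [A = v^T v / a + A'], where
   [A'] has zero first row and column and its remaining block is positive. *)
Lemma sum_pos_neg_le0 (R : realFieldType) (n : nat) (A D : 'I_n -> 'I_n -> R) :
  (forall i j, A i j = A j i) ->
  (forall x : 'I_n -> R, (exists i, x i != 0) ->
    0 < \sum_i \sum_j x i * x j * A i j) ->
  (forall x : 'I_n -> R, \sum_i \sum_j x i * x j * D i j <= 0) ->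
  \sum_i \sum_j A i j * D i j <= 0.
Proof.
elim: n A D => [|n IHn] A D Asym Apos Dneg; first by rewrite big_ord0.
pose a := A ord0 ord0; pose v i := A ord0 i.
have a_gt0 : 0 < a.
  have := Apos (fun i => (i == ord0)%:R).
  rewrite big_ord_recl [X in _ + X]big1; last first.
    by move=> i _; rewrite big1// => j _; rewrite /= !mul0r.
  rewrite big_ord_recl big1; last by move=> i _; rewrite /= mulr0 mul0r.
  by rewrite !eqxx !addr0 !mul1r; apply; exists ord0; rewrite eqxx oner_eq0.
have a_neq0 : a != 0 by rewrite gt_eqF.
pose A' i j := A i j - a^-1 * (v i * v j).
have A'0 j : A' ord0 j = 0 by rewrite /A' mulrA mulVf// mul1r subrr.
have A'0' i : A' i ord0 = 0 by rewrite /A' Asym (mulrC (v i)) -/(A' _ _) A'0.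
have A'sum (E : 'I_n.+1 -> 'I_n.+1 -> R) : \sum_i \sum_j E i j * A' i j =
    \sum_i \sum_j E (lift ord0 i) (lift ord0 j) * A' (lift ord0 i) (lift ord0 j).
  rewrite big_ord_recl big1 ?add0r; last by move=> j _; rewrite A'0 mulr0.
  by apply: eq_bigr => i _; rewrite big_ord_recl A'0' mulr0 add0r.
have AE (E : 'I_n.+1 -> 'I_n.+1 -> R) : \sum_i \sum_j E i j * A i j =
    a^-1 * (\sum_i \sum_j v i * v j * E i j) + \sum_i \sum_j E i j * A' i j.
  rewrite mulr_sumr -big_split; apply: eq_bigr => i _ /=.
  rewrite mulr_sumr -big_split; apply: eq_bigr => j _ /=.
  by rewrite /A'; ring.
rewrite (eq_bigr (fun i => \sum_j D i j * A i j)); last first.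
  by move=> i _; apply: eq_bigr => j _; rewrite mulrC.
rewrite AE A'sum.
rewrite -[leRHS]addr0 lerD//.
  by rewrite pmulr_rle0 ?invr_gt0.
rewrite (eq_bigr (fun i => \sum_j A' (lift ord0 i) (lift ord0 j) *
   D (lift ord0 i) (lift ord0 j))); last first.
  by move=> i _; apply: eq_bigr => j _; rewrite mulrC.
apply: (IHn (fun i j => A' (lift ord0 i) (lift ord0 j))
  (fun i j => D (lift ord0 i) (lift ord0 j))).
- by move=> i j; rewrite /A' Asym (mulrC (v _)).
- move=> x [k xk].
  (* This first coordinate makes [y] orthogonal to [v], so the rank-one part of [A] vanishes at [y]
     and the form of [A] at [y] is that of the remaining block at [x]. *)
  pose s := - a^-1 * \sum_i v (lift ord0 i) * x i.
  pose y i := if unlift ord0 i is Some j then x j else s.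
  have yl i : y (lift ord0 i) = x i by rewrite /y liftK.
  have := Apos y; rewrite AE A'sum.
  have -> : \sum_i \sum_j v i * v j * (y i * y j) = (\sum_i v i * y i) ^+ 2.
    rewrite expr2 mulr_suml; apply: eq_bigr => i _.
    by rewrite mulr_sumr; apply: eq_bigr => j _; ring.
  have -> : \sum_i v i * y i = 0.
    rewrite big_ord_recl /y unlift_none /= -/(y _).
    under eq_bigr => i _ do rewrite liftK.
    by rewrite /s mulrA mulrN divff// mulN1r addNr.
  rewrite expr0n mulr0 add0r.
  under eq_bigr => i _ do under eq_bigr => j _ do rewrite !yl.
  by apply; exists (lift ord0 k); rewrite yl.
- move=> x.
  pose y i := if unlift ord0 i is Some j then x j else 0.
  have yl i : y (lift ord0 i) = x i by rewrite /y liftK.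
  have y0 : y ord0 = 0 by rewrite /y unlift_none.
  have := Dneg y; rewrite big_ord_recl big1 ?add0r; last first.
    by move=> j _; rewrite y0 !mul0r.
  under eq_bigr => i _.
    rewrite big_ord_recl y0 mulr0 mul0r add0r.
    under eq_bigr => j _ do rewrite !yl.
    over.
  done.
Qed.

(** To be applied with [D] the Hessian at a maximum, where it gives the sign of the second-order
    term of [Ltilde]. *)
Lemma dotmat_le0 (R : realType) (n : nat) (A D : 'M[R]_n) (c : R) :
  0 < c -> A^T = A ->
  (forall x : 'rV[R]_n, c * enorm x ^+ 2 <= (x *m A *m x^T) 0 0) ->
  (forall x : 'rV[R]_n, (x *m D *m x^T) 0 0 <= 0) ->
  dotmat A D <= 0.
Proof.
move=> c0 As Ap Dn.
have qE (M : 'M[R]_n) (x : 'I_n -> R) : \sum_i \sum_j x i * x j * M i j =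
    ((\row_i x i) *m M *m (\row_i x i)^T) 0 0.
  rewrite exchange_big mxE; apply: eq_bigr => j _ /=.
  rewrite !mxE mulr_suml; apply: eq_bigr => i _; rewrite mxE; ring.
have -> : dotmat A D = \sum_i \sum_j A i j * D i j.
  rewrite exchange_big; apply: eq_bigr => j _ /=.
  by rewrite mxE; apply: eq_bigr => i _; rewrite mxE.
apply: sum_pos_neg_le0.
- by move=> i j; rewrite -[in LHS]As mxE.
- move=> x [k xk]; rewrite qE; apply: lt_le_trans (Ap _).
  have xpos : 0 < dotv (\row_i x i) (\row_i x i).
    rewrite /dotv (bigD1 k)//= ltr_wpDr//.
      by apply: sumr_ge0 => i _; rewrite -expr2 sqr_ge0.
    by rewrite mxE -expr2 lt_def sqr_ge0 sqrf_eq0 xk.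
  by rewrite mulr_gt0// /enorm sqr_sqrtr// ltW.
- by move=> x; rewrite qE.
Qed.

Lemma dotv_sqrD (R : realType) (n : nat) (z xi : 'rV[R]_n) (s : R) :
  dotv (z + s *: xi) (z + s *: xi) =
  dotv z z + 2 * s * dotv z xi + s ^+ 2 * dotv xi xi.
Proof. by rewrite !(dotvDl, dotvDr, dotvZl, dotvZr) (dotvC xi z); ring. Qed.

Lemma quad_sum (R : realType) (n : nat) (D : 'M[R]_n) (x : 'rV[R]_n) :
  (x *m D *m x^T) 0 0 = \sum_j x 0 j * \sum_i x 0 i * D i j.
Proof. by rewrite mxE; apply: eq_bigr => j _; rewrite !mxE mulrC. Qed.

Lemma quad_rank1_scalar (R : realType) (n : nat) (z xi : 'rV[R]_n) (a c : R) :
  (xi *m (a *: (z^T *m z) - c%:M) *m xi^T) 0 0 =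
  a * dotv z xi ^+ 2 - c * dotv xi xi.
Proof.
have sub00 (B C : 'M[R]_1) : (B - C) 0 0 = B 0 0 - C 0 0 by rewrite !mxE.
have scale00 (r : R) (B : 'M[R]_1) : (r *: B) 0 0 = r * B 0 0 by rewrite !mxE.
rewrite mulmxBr mulmxBl sub00 -scalemxAr -scalemxAl scale00.
rewrite mul_mx_scalar -scalemxAl scale00 -(dotvE xi xi); congr (_ * _ - _).
by rewrite mulmxA -(mulmxA _ z) mxE big_ord1 -!dotvE (dotvC xi z) expr2.
Qed.

(** * Second-order conditions along lines *)

(** If [g2 > 0], then [g1 > g1 0 = 0] just to the right of [0], and the mean value theorem gives
    [g r > g 0] for a small [r > 0]. *)
Lemma second_derivative_test (R : realType) (g g1 : R -> R) (g2 e : R) :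
  0 < e -> (forall s : R, `|s| < e -> is_derive s 1 g (g1 s)) ->
  is_derive (0 : R) 1 g1 g2 ->
  (forall s, `|s| < e -> g s <= g 0) ->
  g1 0 = 0 /\ g2 <= 0.
Proof.
move=> e0 dg dg1 gmax.
have ine s : s \in `]-e, e[ -> `|s| < e by rewrite in_itv/= ltr_norml.
have g10 : g1 0 = 0.
  have d0 : is_derive (0 : R) 1 g 0.
    apply: (@derive1_at_max _ g (-e) e).
    - by rewrite ge0_cp// ltW.
    - by move=> t /ine/dg[].
    - by rewrite in_itv/= oppr_lt0 e0.
    - by move=> t /ine/gmax.
  have d1 : is_derive (0 : R) 1 g (g1 0) by apply: dg; rewrite normr0.
  by have [_ <-] := d1; have [_ ->] := d0.
split=> //; rewrite leNgt; apply/negP => g2_gt0.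
have cv : h^-1 *: (g1 (h *: 1 + 0) - g1 0) @[h --> (0:R)^'] --> g2.
  have [dv <-] := dg1; exact: dv.
have : \forall h \near (0:R)^', 0 < h^-1 *: (g1 (h *: 1 + 0) - g1 0).
  exact: (cvgr_gt _ cv).
rewrite near_withinE => -[d /= d0 hd].
pose r := Num.min d e / 2.
have r0 : 0 < r by rewrite divr_gt0// lt_min d0 e0.
have rd : r < d.
  by rewrite /r ltr_pdivrMr// (@le_lt_trans _ _ d) ?ge_min ?lexx// ltr_pMr// ltr1n.
have re : r < e.
  by rewrite /r ltr_pdivrMr// (@le_lt_trans _ _ e) ?ge_min ?lexx ?orbT// ltr_pMr// ltr1n.
have [s] : exists2 c, c \in `]0, r[%R & g r - g 0 = g1 c * (r - 0).
  apply: MVT => //.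
    move=> x; rewrite in_itv/= => /andP[x0 xr]; apply: dg.
    by rewrite gtr0_norm// (lt_trans xr).
  apply: derivable_within_continuous => x; rewrite in_itv/= => /andP[x0 xr].
  by have /dg[] : `|x| < e by rewrite ger0_norm// (le_lt_trans xr).
rewrite in_itv/= => /andP[s0 sr] E.
have gs : 0 < g1 s.
  have := hd s; rewrite /= sub0r normrN gtr0_norm// (lt_trans sr rd).
  move=> /(_ isT (lt0r_neq0 s0)); rewrite g10 subr0 addr0 [s *: 1]mulr1.
  by rewrite pmulr_rgt0 ?invr_gt0.
have := gmax r; rewrite gtr0_norm// re => /(_ isT); rewrite -subr_le0 E.
by rewrite subr0 leNgt mulr_gt0.
Qed.

Lemma is_derive_lineP (R : realType) (V : normedModType R) (f : V -> R) (z e : V)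
    (s v : R) :
  is_derive (z + s *: e) e f v <-> is_derive s 1 (fun r : R => f (z + r *: e)) v.
Proof.
have E : (fun h : R => h^-1 *: (((fun r : R => f (z + r *: e)) \o shift s) (h *: 1) -
      f (z + s *: e))) =
    (fun h : R => h^-1 *: ((f \o shift (z + s *: e)) (h *: e) - f (z + s *: e))).
  apply/funext => h /=; congr (_ *: (f _ - _)).
  by rewrite [h *: 1]mulr1 scalerDl addrCA.
by split=> -[dv vE]; split; rewrite -?vE /derivable /derive -?E ?E// -E.
Qed.

Lemma MVT_line (R : realType) (V : normedModType R) (f : V -> R) (z e : V) (k : R) :
  (forall s : R, `|s| <= `|k| -> derivable f (z + s *: e) e) ->
  exists2 s : R, `|s| <= `|k| & f (z + k *: e) - f z = k * 'D_e f (z + s *: e).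
Proof.
move=> df.
have [k0|k0] := leP 0 k.
- have sk s : s \in `[0, k] -> `|s| <= `|k|.
    by rewrite in_itv/= => /andP[s0 sk]; rewrite !ger0_norm.
  have [||s /sk sk1] := @MVT_segment _ (fun r : R => f (z + r *: e))
      (fun s => 'D_e f (z + s *: e)) 0 k k0.
  + by move=> s /subset_itv_oo_cc /sk /df/derivableP/is_derive_lineP.
  + by apply: derivable_within_continuous => s /sk /df/derivableP/is_derive_lineP[].
  + by rewrite scale0r addr0 subr0 mulrC; exists s.
- have sk s : s \in `[k, 0] -> `|s| <= `|k|.
    by rewrite in_itv/= => /andP[s0 sk]; rewrite !ler0_norm ?lerN2// ltW.
  have [||s /sk sk1] := @MVT_segment _ (fun r : R => f (z + r *: e))
      (fun s => 'D_e f (z + s *: e)) k 0 (ltW k0).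
  + by move=> s /subset_itv_oo_cc /sk /df/derivableP/is_derive_lineP.
  + by apply: derivable_within_continuous => s /sk /df/derivableP/is_derive_lineP[].
  + rewrite scale0r addr0 sub0r => E; exists s => //.
    by rewrite -opprB E mulrN opprK mulrC.
Qed.

(** The mean value theorem along [e], from the moving base point [x + s *: eta], expresses the
    increment by ['D_e f] at a point that tends to [x]; continuity of ['D_e f] at [x] gives the
    limit. *)
Lemma is_derive_increment (R : realType) (V : normedModType R) (f : V -> R)
    (x e eta : V) (c : R) :
  (\forall y \near x, derivable f y e) ->
  {for x, continuous (fun y => 'D_e f y)} ->
  is_derive (0 : R) 1 (fun s : R => f (x + s *: eta + (s * c) *: e) - f (x + s *: eta))
    (c * 'D_e f x).
Proof.
move=> df cf.
pose d (s : R) := f (x + s *: eta + (s * c) *: e) - f (x + s *: eta).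
suff cv : h^-1 *: ((d \o shift 0) (h *: 1) - d 0) @[h --> (0:R)^'] --> c * 'D_e f x.
  split; first by apply/cvg_ex; exists (c * 'D_e f x).
  by apply: cvg_lim cv.
have d0 : d 0 = 0 by rewrite /d mul0r !scale0r !addr0 subrr.
apply/cvgrPdist_le => eps eps0.
have c1 : 0 < `|c| + 1 by rewrite ltr_wpDl.
have : \forall y \near x, derivable f y e /\ `|'D_e f x - 'D_e f y| <= eps / (`|c| + 1).
  near=> y; split; near: y; first exact: df.
  by move/cvgrPdist_le : cf; apply; rewrite divr_gt0.
move=> /nbhs_ballP[r /= r0 rP].
(* All points met for a parameter [h] lie within [|h| * N] of [x]; the summand [1] keeps [N]
   positive. *)
pose N := `|eta| + `|c| * `|e| + 1.
have N0 : 0 < N by rewrite /N ltr_wpDl// addr_ge0// mulr_ge0.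
rewrite near_withinE; exists (r / N) => /=; first by rewrite divr_gt0.
move=> h; rewrite /= sub0r normrN => hr h0.
rewrite [h *: 1]mulr1 addr0 d0 subr0.
have inb (s : R) : `|s| <= `|h * c| -> ball x r (x + h *: eta + s *: e).
  move=> sh; rewrite -ball_normE /ball_/= -addrA opprD addrA subrr sub0r normrN.
  apply: (@le_lt_trans _ _ (`|h| * N)); last by rewrite -ltr_pdivlMr.
  rewrite (le_trans (ler_normD _ _))// !normrZ.
  apply: (@le_trans _ _ (`|h| * `|eta| + `|h * c| * `|e|)).
    by rewrite lerD2l ler_wpM2r.
  by rewrite /N normrM -mulrA -mulrDr ler_wpM2l// lerDl.
have [s /inb/rP[_ sD] E] := @MVT_line _ _ f (x + h *: eta) e (h * c)
  (fun s sh => proj1 (rP _ (inb s sh))).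
rewrite /d E /= [_ *: _]mulrA mulrA mulVf// mul1r -mulrBr normrM.
apply: (le_trans (ler_wpM2l (normr_ge0 _) sD)).
by rewrite mulrCA ger_pMr// ler_pdivrMr// mul1r lerDl.
Unshelve. all: by end_near. Qed.

(** The coordinates of [xi] are switched on one at a time: each contributes one increment, whose
    base point moves with the coordinates already present. *)
Lemma is_derive_dir (R : realType) (n : nat) (f : 'rV[R]_n -> R) (x xi : 'rV[R]_n) :
  (forall i, \forall y \near x, derivable f y (delta_mx 0 i)) ->
  (forall i, {for x, continuous (fun y => 'D_(delta_mx 0 i) f y)}) ->
  is_derive x xi f (\sum_i xi 0 i * 'D_(delta_mx 0 i) f x).
Proof.
move=> df cf.
suff : is_derive (0 : R) 1 (fun s : R => f (x + s *: xi))
    (\sum_i xi 0 i * 'D_(delta_mx 0 i) f x).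
  by move/is_derive_lineP; rewrite scale0r addr0.
suff H (s : seq 'I_n) :
    is_derive (0 : R) 1 (fun r : R => f (x + r *: (\sum_(i <- s) xi 0 i *: delta_mx 0 i)))
      (\sum_(i <- s) xi 0 i * 'D_(delta_mx 0 i) f x).
  by rewrite [in X in is_derive _ _ X _](row_sum_delta xi).
elim: s => [|i s IH].
  under [X in is_derive _ _ X _]eq_fun do rewrite big_nil scaler0 addr0.
  by rewrite big_nil; exact: is_derive_cst.
rewrite [X in is_derive _ _ _ X]big_cons.
set eta := \sum_(j <- s) _ in IH.
have -> : (fun s0 : R => f (x + s0 *: (\sum_(j <- i :: s) xi 0 j *: delta_mx 0 j))) =
  (fun r : R => f (x + r *: eta + (r * xi 0 i) *: delta_mx 0 i) - f (x + r *: eta)) +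
  (fun r : R => f (x + r *: eta)).
  apply/funext => r; rewrite big_cons /=.
  rewrite -[RHS]/(_ - _ + _) subrK; congr f.
  by rewrite scalerDr scalerA -addrA; congr (_ + _); rewrite addrC.
by apply: is_deriveD; apply: is_derive_increment.
Qed.

(** Here [f] will be [w] at a frozen time and [h] the barrier on the line, which has explicit
    derivatives. The second derivative of [f] along the line comes from [is_derive_dir], applied to
    [f] and then to each of its partial derivatives. *)
Lemma max_along_line (R : realType) (n : nat) (U : set 'rV[R]_n)
    (f : 'rV[R]_n -> R) (x xi : 'rV[R]_n) (h h1 : R -> R) (h2 : R) :
  open U -> U x ->
  (forall i y, U y -> derivable f y (delta_mx 0 i)) ->
  (forall i y, U y -> {for y, continuous (fun y => 'D_(delta_mx 0 i) f y)}) ->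
  (forall i j y, U y ->
    derivable (fun y => 'D_(delta_mx 0 j) f y) y (delta_mx 0 i)) ->
  (forall i j, {for x, continuous (fun y =>
    'D_(delta_mx 0 i) (fun z => 'D_(delta_mx 0 j) f z) y)}) ->
  (forall s : R, is_derive s 1 h (h1 s)) -> is_derive (0 : R) 1 h1 h2 ->
  (forall s : R, U (x + s *: xi) -> f (x + s *: xi) + h s <= f x + h 0) ->
  \sum_i xi 0 i * 'D_(delta_mx 0 i) f x + h1 0 = 0 /\
  \sum_j xi 0 j * (\sum_i xi 0 i *
    'D_(delta_mx 0 i) (fun z => 'D_(delta_mx 0 j) f z) x) + h2 <= 0.
Proof.
move=> oU Ux df cf d2f c2f dh dh1 fmax.
have nearU y (P : set 'rV[R]_n) : U y -> (forall z, U z -> P z) -> \forall z \near y, P z.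
  move=> Uy UP; apply: filterS (open_nbhs_nbhs (conj oU Uy)); exact: UP.
have /nbhs_ballP[r /= r0 rU] : nbhs x U by exact: nearU.
have N0 : 0 < `|xi| + 1 by rewrite ltr_wpDl.
pose e := r / (`|xi| + 1).
have sU s : `|s| < e -> U (x + s *: xi).
  move=> se; apply: rU; rewrite -ball_normE /ball_/= opprD addrA subrr sub0r.
  rewrite normrN normrZ; apply: (@le_lt_trans _ _ (`|s| * (`|xi| + 1))).
    by rewrite ler_wpM2l// lerDl.
  by rewrite -ltr_pdivlMr.
have dirf y : U y -> is_derive y xi f (\sum_i xi 0 i * 'D_(delta_mx 0 i) f y).
  move=> Uy; apply: is_derive_dir => i; last exact: cf.
  by apply: nearU => // z; exact: df.
have dirf1 : is_derive x xi (\sum_j xi 0 j *: (fun z => 'D_(delta_mx 0 j) f z))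
    (\sum_j xi 0 j *: (\sum_i xi 0 i *
    'D_(delta_mx 0 i) (fun z => 'D_(delta_mx 0 j) f z) x)).
  apply: is_derive_sum => j; apply: is_deriveZ; apply: is_derive_dir => i.
    by apply: nearU => // z; exact: d2f.
  exact: c2f.
have [||||g10 g20] := @second_derivative_test R (fun s => f (x + s *: xi) + h s)
  (fun s => \sum_i xi 0 i * 'D_(delta_mx 0 i) f (x + s *: xi) + h1 s)
  (\sum_j xi 0 j * (\sum_i xi 0 i *
    'D_(delta_mx 0 i) (fun z => 'D_(delta_mx 0 j) f z) x) + h2) e.
- by rewrite divr_gt0.
- move=> s /sU /dirf /is_derive_lineP dfs.
  exact: (is_deriveD dfs (dh s)).
- have := dirf1; rewrite -{1}[x]addr0 -(scale0r xi) => /is_derive_lineP d0.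
  have := is_deriveD d0 dh1.
  have -> // : (fun r : R => (\sum_j xi 0 j *: (fun z => 'D_(delta_mx 0 j) f z)) (x + r *: xi))
    = (fun s => \sum_i xi 0 i * 'D_(delta_mx 0 i) f (x + s *: xi)).
  by apply/funext => s; rewrite fct_sumE.
- by move=> s /sU /fmax; rewrite scale0r addr0.
- by move: g10; rewrite scale0r addr0; split.
Qed.

(** * The barrier *)

(* Here [a] stands for [|x - x0|^2 / (4 c0)].  At [t = 0] the junk value
   [0 `^ (- beta) = 0] happens to be the continuous extension. *)
Definition heat_barrier {R : realType} (beta a t : R) : R :=
  t `^ (- beta) * expR (- a / t).

(* The value of [heat_barrier beta a] at its maximum point [t = a / beta]. *)
Definition heat_barrier_max {R : realType} (beta a : R) : R :=
  expR (beta * ln (beta / a) - beta).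

Section heat_barrier_theory.
Context {R : realType}.
Implicit Types beta a t : R.

Lemma heat_barrierE beta a t : 0 < t ->
  heat_barrier beta a t = expR (- beta * ln t - a / t).
Proof.
by move=> t0; rewrite /heat_barrier /powR gt_eqF// -expRD !mulNr.
Qed.

Lemma heat_barrier0 beta a : beta != 0 -> heat_barrier beta a 0 = 0.
Proof. by move=> b0; rewrite /heat_barrier powR0 ?oppr_eq0// mul0r. Qed.

Lemma heat_barrier_ge0 beta a t : 0 <= heat_barrier beta a t.
Proof. by rewrite mulr_ge0 ?powR_ge0 ?expR_ge0. Qed.

Lemma heat_barrier_le beta a t : 0 < beta -> 0 < a -> 0 < t ->
  heat_barrier beta a t <= heat_barrier_max beta a.
Proof.
move=> b0 a0 t0; rewrite heat_barrierE// ler_expR.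
(* After taking logarithms and dividing by [beta], the claim becomes [1 + ln y <= y]. *)
pose y := a / (beta * t).
have y0 : 0 < y by rewrite divr_gt0// mulr_gt0.
have yE : a / t = beta * y by rewrite /y; field; rewrite !gt_eqF.
have -> : beta / a = (t * y)^-1 by rewrite /y; field; rewrite !gt_eqF.
clearbody y; rewrite lnV ?posrE ?mulr_gt0// lnM ?posrE// yE.
have : 1 + ln y <= y by have := expR_ge1Dx (ln y); rewrite lnK// posrE.
rewrite -(ler_pM2l b0); lra.
Qed.

Lemma heat_barrier_max_le beta a a' : 0 < beta -> 0 < a -> a <= a' ->
  heat_barrier_max beta a' <= heat_barrier_max beta a.
Proof.
move=> b0 a0 aa'; have a'0 : 0 < a' := lt_le_trans a0 aa'.
rewrite ler_expR lerD2r ler_pM2l// ler_ln ?posrE ?divr_gt0//.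
by rewrite ler_pM2l// lef_pV2// posrE.
Qed.

(* [heat_barrier beta a t = t * heat_barrier (beta + 1) a t] makes the barrier
   vanish at [t = 0] uniformly in [a]. *)
Lemma heat_barrier_le_time beta a t : 0 < beta -> 0 < a -> 0 <= t ->
  heat_barrier beta a t <= t * heat_barrier_max (beta + 1) a.
Proof.
move=> b0 a0; rewrite le_eqVlt => /predU1P[<-|t0].
  by rewrite heat_barrier0 ?gt_eqF// mul0r.
have -> : heat_barrier beta a t = t * heat_barrier (beta + 1) a t.
  rewrite !heat_barrierE// -[X in _ = X * _](@lnK _ t) ?posrE// -expRD.
  by congr expR; ring.
by rewrite ler_pM2l// heat_barrier_le// addr_gt0.
Qed.

Lemma is_derive_heat_barrier_time beta a t : 0 < t ->
  is_derive t 1 (heat_barrier beta a)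
    (heat_barrier beta a t * (- beta / t + a / t ^+ 2)).
Proof.
move=> t0.
have t0' : t != 0 by rewrite gt_eqF.
have d1 := is_derive1_powR (- beta) t0.
have d2 : is_derive t 1 (fun s : R => - a / s) (a / t ^+ 2).
  have := @is_deriveZ _ _ _ (fun s : R => s^-1) (- a) t 1 _ (is_deriveV t0' (is_derive_id t 1)).
  move=> dd; apply: (is_derive_eq dd).
  by rewrite /GRing.scale/=; field.
have d3 := @is_derive1_comp _ (@expR R) _ _ _ _ (is_derive_expR _) d2.
have := is_deriveM d1 d3.
move=> dd; apply: (is_derive_eq dd).
rewrite /heat_barrier /GRing.scale/=. rewrite powRB ?t0' ?implybT// powRr1 ?ltW//.
by field; rewrite gt_eqF.
Qed.

(** With [q = |z|^2], [d = z . xi] and [e = |xi|^2] the exponent is [- k |z + r xi|^2]: this is the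
    barrier on a line at a frozen time. *)
Lemma is_derive_gauss_line (K q d e k s : R) :
  is_derive s 1 (fun r => K * expR (- (q + 2 * r * d + r ^+ 2 * e) * k))
   (K * expR (- (q + 2 * s * d + s ^+ 2 * e) * k) * (- (2 * d + 2 * s * e) * k)).
Proof.
have d1 : is_derive s 1 (fun r : R => - (q + 2 * r * d + r ^+ 2 * e) * k)
    (- (2 * d + 2 * s * e) * k).
  apply: is_derive_eq.
  rewrite /GRing.scale/=; ring.
have d3 := @is_derive1_comp _ (@expR R) _ _ _ _ (is_derive_expR _) d1.
have := @is_deriveZ _ _ _ _ K _ _ _ d3.
move=> dd; apply: (is_derive_eq dd).
by rewrite /GRing.scale/= mulrA.
Qed.

Lemma is_derive_gauss_line2 (K q d e k : R) :
  is_derive (0 : R) 1 (fun s => K * expR (- (q + 2 * s * d + s ^+ 2 * e) * k) *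
      (- (2 * d + 2 * s * e) * k))
   (K * expR (- q * k) * ((2 * d * k) ^+ 2 - 2 * e * k)).
Proof.
have d1 := is_derive_gauss_line K q d e k 0.
have d2 : is_derive (0 : R) 1 (fun s : R => - (2 * d + 2 * s * e) * k) (- (2 * e) * k).
  apply: is_derive_eq.
  rewrite /GRing.scale/=; ring.
have := is_deriveM d1 d2.
move=> dd; apply: (is_derive_eq dd).
rewrite /GRing.scale/= !mulr0 !mul0r expr0n/= mul0r !addr0; ring.
Qed.

(** At this time the exponent is at least [- beta], because [q <= r ^+ 2], which matches the factor
    [expR (- beta)] of [heat_barrier_max]. The remaining powers agree exactly, so equality holds for
    [q = r ^+ 2]. *)
Lemma heat_barrier_ratio (beta c q r0 r : R) :
  0 < beta -> 0 < c -> 0 < r0 -> q <= r ^+ 2 -> 0 < r ->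
  (r0 / r) `^ (2 * beta) * heat_barrier_max beta (r0 ^+ 2 / c) <=
  heat_barrier beta (q / c) (r ^+ 2 / (c * beta)).
Proof.
move=> b0 c0 r00 qr rp.
have t0 : 0 < r ^+ 2 / (c * beta) by rewrite divr_gt0 ?exprn_gt0 ?mulr_gt0.
rewrite heat_barrierE// /powR gt_eqF ?divr_gt0// -expRD ler_expR.
have -> : ln (r ^+ 2 / (c * beta)) = 2 * ln r - ln c - ln beta.
  rewrite ln_div ?posrE ?exprn_gt0 ?mulr_gt0// lnXn// lnM ?posrE//.
  by rewrite -mulr_natl; ring.
have -> : beta / (r0 ^+ 2 / c) = beta * c / r0 ^+ 2.
  by field; rewrite !gt_eqF.
rewrite !ln_div ?posrE ?exprn_gt0 ?mulr_gt0// lnXn// lnM ?posrE// -mulr_natl.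
have : q / c / (r ^+ 2 / (c * beta)) <= beta.
  have -> : q / c / (r ^+ 2 / (c * beta)) = beta * (q / r ^+ 2).
    by field; rewrite !gt_eqF.
  by rewrite ger_pMr// ler_pdivrMr ?exprn_gt0// mul1r.
lra.
Qed.

End heat_barrier_theory.

(** * Maximum principle *)

(* Only times before [t] are used, so that [t = T] is allowed. *)
Lemma deriv_t_ge (R : realType) (n : nat) (u : 'rV[R]_n * R -> R) (x : 'rV[R]_n)
    (t T c : R) :
  0 < t <= T -> derivable_t `]0, T] u (x, t) ->
  (forall e, 0 < e ->
    \forall s \near t^'-, (c - e) * (t - s) <= u (x, t) - u (x, s)) ->
  c <= deriv_t `]0, T] u (x, t).
Proof.
move=> /andP[t0 tT] du uge; apply/ler_addgt0Pr => e e0.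
rewrite -lerBlDr.
(* Since [0 < t <= T], times just before [t] belong to []0, T]], so the limit defining [deriv_t] can
   be taken from the left. *)
have sub : t^'- `=>` within `]0, T]%classic t^'.
  move=> P HP.
  have HP' : \forall s \near t^'-, s != t -> s \in `]0, T] -> P s.
    by apply: cvg_within; apply: filterS HP => r.
  near=> s.
  have st : s < t by near: s; exact: nbhs_left_lt.
  apply: (near HP' s) => //.
  by rewrite in_itv/= (le_trans (ltW st) tT) andbT; near: s; exact: nbhs_left_gt.
have cv : time_quot u (x, t) s @[s --> t^'-] --> deriv_t `]0, T] u (x, t).
  by apply: cvg_trans du; apply: cvg_app.
have e0' : (c - e <= lim (time_quot u (x, t) s @[s --> t^'-])) -> c - e <= deriv_t `]0, T] u (x, t).
  by rewrite (cvg_lim _ cv).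
apply: e0'; apply: limr_ge; first by apply/cvg_ex; eexists; exact: cv.
near=> s.
have st : 0 < t - s by rewrite subr_gt0; near: s; exact: nbhs_left_lt.
have -> : time_quot u (x, t) s = (u (x, t) - u (x, s)) / (t - s).
  by rewrite /time_quot/= -[t - s]opprB invrN mulrN -mulNr opprB.
by rewrite ler_pdivlMr//; near: s; exact: uge.
Unshelve. all: by end_near. Qed.

Lemma is_derive_left_ge (R : realType) (k : R -> R) (t k' e : R) :
  is_derive t 1 k k' -> 0 < e ->
  \forall s \near t^'-, (k' - e) * (t - s) <= k t - k s.
Proof.
move=> [dk <-] e0.
have /cvgrPdist_le/(_ _ e0) : h^-1 *: ((k \o shift t) (h *: 1) - k t) @[h --> (0:R)^'] --> 'D_1 k t.
  exact: dk.
rewrite !near_withinE => -[d /= d0 dP]; exists d => //= s /= std st.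
have st0 : 0 < t - s by rewrite subr_gt0.
have := dP (s - t); rewrite /= sub0r normrN distrC => /(_ std).
rewrite subr_eq0 lt_eqF// => /(_ isT).
rewrite [_ *: 1]mulr1 subrK /GRing.scale/= => /ler_normlW.
have -> : (s - t)^-1 * (k s - k t) = (k t - k s) / (t - s).
  by rewrite -[s - t]opprB invrN mulNr -mulrN opprB mulrC.
by rewrite lerBlDr addrC -lerBlDr ler_pdivlMr.
Qed.

Lemma integral_increment_ge (R : realType) (F : R -> R) (s t c : R) :
  0 <= s <= t -> {within `[0, t], continuous F} ->
  (forall r, s <= r <= t -> c <= F r) ->
  c * (t - s) <= parameterized_integral lebesgue_measure 0 t F -
     parameterized_integral lebesgue_measure 0 s F.
Proof.
move=> /andP[s0 st] cF Fge; rewrite /parameterized_integral.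
have iF : lebesgue_measure.-integrable `[0, t] (EFin \o F).
  by apply: continuous_compact_integrable => //; exact: segment_compact.
rewrite Rintegral_itvB//.
have iF' : lebesgue_measure.-integrable `]s, t] (EFin \o F).
  apply: integrableS iF => //= r /=; rewrite !in_itv/= => /andP[sr ->].
  by rewrite (le_trans s0 (ltW sr)).
have -> : c * (t - s) = \int[lebesgue_measure]_(r in `]s, t]) c.
  rewrite Rintegral_cst//= lebesgue_measure_itv/= lte_fin.
  by move: st; rewrite le_eqVlt => /predU1P[->|->//]; rewrite ltxx subrr.
apply: le_Rintegral => //=.
  apply: integrableS (_ : lebesgue_measure.-integrable `[s, t] _) => //=.
    exact: subset_itv_oc_cc.
  apply: continuous_compact_integrable; first exact: segment_compact.
  by apply: continuous_subspaceT => x; exact: cvg_cst.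
by move=> r /=; rewrite in_itv/= => /andP[sr rt]; rewrite Fge// (ltW sr).
Qed.

(** A one-sided substitute for the fundamental theorem of calculus: at [t = T] only continuity of
    [F] from the left is known. *)
Lemma integral_left_ge (R : realType) (F : R -> R) (t e : R) :
  0 < t -> {within `[0, t], continuous F} -> 0 < e ->
  \forall s \near t^'-, (F t - e) * (t - s) <=
     parameterized_integral lebesgue_measure 0 t F -
     parameterized_integral lebesgue_measure 0 s F.
Proof.
move=> t0 cF e0.
have [_ _ cFt] := (continuous_within_itvP F t0).1 cF.
have : \forall s \near t^'-, F t - e < F s.
  by apply: (cvgr_gt _ cFt); rewrite ltrBlDr ltrDl.
rewrite near_withinE => -[d /= d0 dP].
near=> s; apply: integral_increment_ge => //.
  rewrite (ltW (_ : 0 < s)); last by near: s; exact: nbhs_left_gt.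
  by rewrite ltW//; near: s; exact: nbhs_left_lt.
move=> r /andP[sr]; rewrite le_eqVlt => /predU1P[->|rt].
  by rewrite lerBlDr lerDl ltW.
apply/ltW/dP => //=; rewrite ger0_norm ?subr_ge0 ?(ltW rt)//.
rewrite ltrBlDr -ltrBlDl (lt_le_trans _ sr)//; near: s.
by apply: nbhs_left_gt; rewrite ltrBlDr ltrDl.
Unshelve. all: by end_near. Qed.

Lemma continuous_slice (R : realType) (n : nat) (U : set 'rV[R]_n) (I : set R)
    (g : 'rV[R]_n * R -> R) (x : 'rV[R]_n) (t : R) :
  open U -> U x -> I t -> {within U `*` I, continuous g} ->
  {for x, continuous (fun y => g (y, t))}.
Proof.
move=> oU Ux It /subspace_continuousP/(_ (x, t) (conj Ux It)) cg.
apply: cvg_trans cg => P; rewrite /within/= => -[[V W] /= [nV nW] VW].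
have nU : nbhs x U by exact: open_nbhs_nbhs.
apply: filterS2 nV nU => y Vy Uy; apply: (VW (y, t)) => //=.
by split=> //=; exact: nbhs_singleton.
Qed.

Lemma heat_barrier_no_interior_max (R : realType) (n : nat) (U : set 'rV[R]_n)
    (T : R) (A : 'rV[R]_n * R -> 'M[R]_n) (b : 'rV[R]_n * R -> 'rV[R]_n)
    (c0 M1 M2 R0 m e : R) (x0 x : 'rV[R]_n) (t : R)
    (w : 'rV[R]_n * R -> R) (F : R -> R) :
  let phi y s :=
    heat_barrier ((M1 + M2 * R0) / (2 * c0)) (dotv (y - x0) (y - x0) / (4 * c0)) s in
  let v y s := w (y, s) + m * phi y s -
    parameterized_integral lebesgue_measure 0 s F - e * s in
  open U -> U x -> 0 < t <= T -> 0 < c0 -> 0 <= m -> 0 < e ->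
  (A (x, t))^T = A (x, t) ->
  (forall xi : 'rV[R]_n,
    c0 * enorm xi ^+ 2 <= (xi *m A (x, t) *m xi^T) 0 0) ->
  \tr (A (x, t)) <= M1 -> enorm (b (x, t)) <= M2 -> enorm (x - x0) <= R0 ->
  C21 U `]0, T] w -> {within `[0, T], continuous F} ->
  Ltilde `]0, T] A b w (x, t) <= F t ->
  (forall y s, U y -> 0 < s <= t -> v y s <= v x t) -> False.
Proof.
move=> phi v oU Ux /andP[t0 tT] c00 m0 e0 As Ae At bM xR.
move=> [_ [dt _] dx d2x] cF Lw vmax.
have It : t \in `]0, T] by rewrite in_itv/= t0.
have UI y : U y -> (U `*` `]0, T]) (y, t) by [].
pose z := x - x0; pose q := dotv z z; pose k := (4 * c0 * t)^-1.
pose beta := (M1 + M2 * R0) / (2 * c0).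
pose K := m * t `^ (- beta).
pose p0 := m * phi x t.
have p00 : 0 <= p0 by rewrite mulr_ge0// heat_barrier_ge0.
have phiE xi s : m * phi (x + s *: xi) t =
    K * expR (- (q + 2 * s * dotv z xi + s ^+ 2 * dotv xi xi) * k).
  rewrite /phi /heat_barrier mulrA -/beta -/K; congr (_ * expR _).
  have -> : x + s *: xi - x0 = z + s *: xi by rewrite addrAC.
  rewrite dotv_sqrD -/q /k.
  by field; rewrite !gt_eqF.
have p0E : K * expR (- q * k) = p0.
  by have := phiE 0 0; rewrite scale0r addr0 -/p0 mulr0 mul0r expr0n mul0r !addr0.
have line (xi : 'rV[R]_n) :
    \sum_i xi 0 i * deriv_x i w (x, t) = p0 * (2 * dotv z xi * k) /\
    \sum_j xi 0 j * (\sum_i xi 0 i * deriv_x i (deriv_x j w) (x, t)) +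
       p0 * ((2 * dotv z xi * k) ^+ 2 - 2 * dotv xi xi * k) <= 0.
  have [|||||||g1 g2] := @max_along_line R n U (fun y => w (y, t)) x xi
    (fun s => K * expR (- (q + 2 * s * dotv z xi + s ^+ 2 * dotv xi xi) * k))
    (fun s => K * expR (- (q + 2 * s * dotv z xi + s ^+ 2 * dotv xi xi) * k) *
      (- (2 * dotv z xi + 2 * s * dotv xi xi) * k))
    (K * expR (- q * k) * ((2 * dotv z xi * k) ^+ 2 - 2 * dotv xi xi * k)) oU Ux.
  - move=> i y Uy; exact: (dx i).1 (UI _ Uy).
  - by move=> i y Uy; apply: continuous_slice (dx i).2.
  - by move=> i j y Uy; exact: (d2x i j).1 (UI _ Uy).
  - by move=> i j; apply: continuous_slice (d2x i j).2.
  - exact: is_derive_gauss_line.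
  - exact: is_derive_gauss_line2.
  - move=> s Us; have := vmax _ t Us; rewrite t0 lexx => /(_ isT).
    rewrite /v !lerD2r phiE.
    by have := phiE xi 0; rewrite scale0r addr0 => ->.
  - split; last by rewrite -p0E.
    move/eqP: g1; rewrite addr_eq0 => /eqP; rewrite /deriv_x/= => ->.
    by rewrite !mulr0 !mul0r expr0n/= mul0r !addr0 p0E; ring.
have grad_ge : - (p0 * (2 * k) * (M2 * R0)) <= dotv (b (x, t)) (grad_x w (x, t)).
  have -> : dotv (b (x, t)) (grad_x w (x, t)) =
      \sum_i b (x, t) 0 i * deriv_x i w (x, t).
    by apply: eq_bigr => i _; rewrite mxE.
  rewrite (line _).1.
  have : - (M2 * R0) <= dotv z (b (x, t)).
    have /ler_normlP[+ _] := dotv_le z (b (x, t)).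
    rewrite lerNl; apply: le_trans; rewrite lerN2 mulrC.
    by rewrite ler_pM ?enorm_ge0.
  have : 0 <= p0 * (2 * k) by rewrite mulr_ge0// mulr_ge0// invr_ge0 !mulr_ge0// ltW.
  move=> pk0 h; have := ler_wpM2l pk0 h.
  by rewrite mulrN => /le_trans; apply; rewrite le_eqVlt; apply/orP; left; apply/eqP; ring.
have hess_ge : p0 * (4 * k ^+ 2 * (c0 * q) - 2 * k * M1) <=
   - dotmat (A (x, t)) (hess_x w (x, t)).
  (* The Hessian of [w + m * phi]: the second summand is that of the Gaussian [m * phi], whose value
     at the point is [p0]. *)
  pose D := hess_x w (x, t) + p0 *: ((2 * k) ^+ 2 *: (z^T *m z) - (2 * k)%:M).
  have Dn (xi : 'rV[R]_n) : (xi *m D *m xi^T) 0 0 <= 0.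
    have := (line xi).2; apply: le_trans; rewrite le_eqVlt; apply/orP; left; apply/eqP.
    rewrite mulmxDr mulmxDl mxE quad_sum; congr (_ + _).
      apply: eq_bigr => j _; congr (_ * _).
      by apply: eq_bigr => i _; rewrite mxE.
    rewrite -scalemxAr -scalemxAl mxE quad_rank1_scalar; ring.
  have := dotmat_le0 _ _ _ _ _ c00 As Ae Dn.
  have -> : dotmat (A (x, t)) D = dotmat (A (x, t)) (hess_x w (x, t)) +
      p0 * ((2 * k) ^+ 2 * (z *m A (x, t) *m z^T) 0 0 - 2 * k * \tr (A (x, t))).
    rewrite /dotmat As mulmxDr mxtraceD; congr (_ + _).
    rewrite -scalemxAr mxtraceZ mulmxBr raddfB /= -scalemxAr mxtraceZ.
    rewrite mul_mx_scalar mxtraceZ; congr (_ * (_ * _ - _)).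
    by rewrite mulmxA mxtrace_mulC mulmxA /mxtrace big_ord1.
  have := Ae z; rewrite enormE -/q => Aq.
  have k0 : 0 <= 2 * k by rewrite mulr_ge0// invr_ge0 !mulr_ge0// ltW.
  have h1 := ler_wpM2l (sqr_ge0 (2 * k)) Aq.
  have h2 := ler_wpM2l k0 At.
  have h3 := ler_wpM2l p00 (lerB h1 h2).
  move=> hD; rewrite -[leRHS]add0r lerBrDr addrC; apply: le_trans hD.
  by rewrite lerD2l (le_trans _ h3)// le_eqVlt; apply/orP; left; apply/eqP; ring.
have dt_ge : F t + (e - p0 * (- beta / t + q / (4 * c0) / t ^+ 2)) <=
    deriv_t `]0, T] w (x, t).
  (* From [v x s <= v x t], the increments of [w] before [t] dominate those of [e * s - m * phi x s]
     plus the integral of [F]; each of these two gets half of the error [d]. *)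
  apply: deriv_t_ge; [by rewrite t0|exact: dt|] => d d0.
  have d20 : 0 < d / 2 by rewrite divr_gt0.
  have dk : is_derive t 1 (fun s => e * s - m * phi x s)
      (e - p0 * (- beta / t + q / (4 * c0) / t ^+ 2)).
    have h1 := @is_deriveZ _ _ _ (fun s => s) e t 1 _ (is_derive_id t 1).
    have h2 := @is_deriveZ _ _ _ _ m _ _ _ (is_derive_heat_barrier_time beta (q / (4 * c0)) _ t0).
    apply: (is_derive_eq (is_deriveB h1 h2)).
    by rewrite /GRing.scale/= mulr1 /p0 /phi -/beta -/z -/q mulrA.
  have cFt : {within `[0, t], continuous F}.
    apply: continuous_subspaceW cF; apply: subset_itvl; rewrite bnd_simp//.
  have near1 := is_derive_left_ge _ _ _ _ _ dk d20.
  have near2 := integral_left_ge _ _ _ _ t0 cFt d20.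
  near=> s.
  have h1 : (e - p0 * (- beta / t + q / (4 * c0) / t ^+ 2) - d / 2) * (t - s) <=
      e * t - m * phi x t - (e * s - m * phi x s) by near: s; exact: near1.
  have h2 : (F t - d / 2) * (t - s) <=
     parameterized_integral lebesgue_measure 0 t F -
     parameterized_integral lebesgue_measure 0 s F by near: s; exact: near2.
  have : v x s <= v x t.
    apply: vmax => //; apply/andP; split; first by near: s; exact: nbhs_left_gt.
    by apply: ltW; near: s; exact: nbhs_left_lt.
  rewrite /v; lra.
(* Adding the three bounds, all terms in [p0] cancel: [4 * c0] in the exponent matches the terms in
   [q / t ^+ 2], and [beta] matches those in [1 / t]. *)
have : F t + e <= F t.
  apply: le_trans Lw; rewrite /Ltilde.
  apply: le_trans (lerD (lerD dt_ge hess_ge) grad_ge).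
  rewrite le_eqVlt; apply/orP; left; apply/eqP.
  rewrite /beta /k; field; rewrite !gt_eqF//.
by rewrite gerDl leNgt e0.
Unshelve. all: by end_near. Qed.

(** * Compactness and continuity on the closed cylinder *)

Lemma closure_bounded_compact (R : realType) (n : nat) (U : set 'rV[R]_n) :
  bounded_set U -> compact (closure U).
Proof.
move=> [M [Mr UM]]; apply: bounded_closed_compact; last exact: closed_closure.
exists M; split=> // r Mr' x cUx; apply/ler_addgt0Pr => e e0.
have [y [Uy]] := cUx _ (nbhsx_ballx x e e0).
rewrite -ball_normE /ball_/= => xye.
rewrite -[x](subrK y) (le_trans (ler_normD _ _))// addrC lerD//; last exact: ltW.
exact: UM.
Qed.

(** Ensures that the lateral [max_on] is a true maximum and not the default value of [get]. For
    [n = 0] the space is a single point and the boundary is empty. *)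
Lemma boundary_neq0 (R : realType) (n : nat) (U : set 'rV[R]_n) :
  (1 <= n)%N -> U !=set0 -> bounded_set U -> boundary U !=set0.
Proof.
case: n U => // n U _ U0 Ub.
have cU := closure_bounded_compact _ _ _ Ub.
have cU0 : closure U !=set0 by case: U0 => x Ux; exists x; exact: subset_closure.
have [|x xU xmax] := @compact_EVT_max _ R (fun x : 'rV[R]_n.+1 => x 0 0) _ cU0 cU.
  by apply: continuous_subspaceT => x; exact: coord_continuous.
exists x; split; first exact/set_mem.
move=> /nbhs_ballP[e /= e0 eU].
(* Where the first coordinate is maximal, one cannot move along [e_0]. *)
pose N := `|delta_mx 0 0 : 'rV[R]_n.+1| + 1.
have N0 : 0 < N by rewrite ltr_wpDl.
have d0 : 0 < e / (2 * N) by rewrite divr_gt0// mulr_gt0.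
pose y := x + (e / (2 * N)) *: delta_mx 0 0.
have : closure U y.
  apply/subset_closure/eU; rewrite -ball_normE /ball_/= /y opprD addrA subrr sub0r normrN.
  rewrite normrZ gtr0_norm//.
  apply: (@le_lt_trans _ _ (e / (2 * N) * N)); first by rewrite ler_wpM2l ?lerDl// ltW.
  have -> : e / (2 * N) * N = e / 2 by field; rewrite !gt_eqF.
  by rewrite ltr_pdivrMr// ltr_pMr// ltr1n.
by move=> /mem_set /xmax; rewrite !mxE !eqxx mulr1 gerDl leNgt d0.
Qed.

(** Only [t = 0] is delicate. There the barrier is squeezed between [0] and a multiple of [t] that
    does not depend on [x], thanks to the uniform bound [a <= q x]. *)
Lemma heat_barrier_continuous (R : realType) (X : topologicalType) (D : set X)
    (q : X -> R) (beta a T : R) :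
  0 < beta -> 0 < a -> (forall x, D x -> a <= q x) -> continuous q ->
  {within D `*` `[0, T], continuous (fun p : X * R => heat_barrier beta (q p.1) p.2)}.
Proof.
move=> b0 a0 qa cq; apply/subspace_continuousP => -[x t] [/= Dx].
rewrite in_itv/= => /andP[+ tT]; rewrite le_eqVlt => /predU1P[<-|t0].
  rewrite /from_subspace/= heat_barrier0 ?gt_eqF//.
  have cvK : p.2 * heat_barrier_max (beta + 1) a
      @[p --> within (D `*` `[0, T]) (nbhs (x, 0 : R))] --> (0 : R).
    rewrite -[X in _ --> X](mul0r (heat_barrier_max (beta + 1) a)).
    apply: cvgM; last exact: cvg_cst.
    by apply: cvg_within_filter; exact: cvg_snd.
  apply: (squeeze_cvgr _ (cvg_cst 0) cvK).
  rewrite near_withinE; near=> p => -[Dp]; rewrite /= in_itv/= => /andP[p0 _].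
  rewrite heat_barrier_ge0/=.
  have qp := qa _ Dp; have q0 := lt_le_trans a0 qp.
  apply: (le_trans (heat_barrier_le_time _ _ _ b0 q0 p0)).
  by rewrite ler_wpM2l// heat_barrier_max_le// addr_gt0.
apply: cvg_within_filter; rewrite /from_subspace /heat_barrier.
apply: cvgM.
  have /derivable1_diffP/differentiable_continuous cp :=
    @ex_derive _ _ _ _ _ _ _ (is_derive1_powR (- beta) t0).
  by apply: (@cvg_comp _ _ _ (snd : X * R -> R) (fun s => s `^ (- beta)) _ (nbhs t));
    [exact: cvg_snd|exact: cp].
apply: (@cvg_comp _ _ _ (fun p : X * R => - q p.1 / p.2) (@expR R) _ (nbhs (- q x / t)));
  last exact: continuous_expR.
apply: cvgM; last by apply: cvgV; [rewrite gt_eqF|exact: cvg_snd].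
apply: cvgN; apply: (@cvg_comp _ _ _ fst q _ (nbhs x)); [exact: cvg_fst|exact: cq].
Unshelve. all: by end_near. Qed.

Lemma pospart_within_continuous (R : realType) (X : topologicalType) (D : set X)
    (w : X -> R) :
  {within D, continuous w} -> {within D, continuous (pospart w)}.
Proof.
move=> cw x; apply: (@continuous_max R (subspace D) (cst 0) w); last exact: cw.
exact: cvg_cst.
Qed.

Lemma within_continuous_slice (R : realType) (X : topologicalType) (D : set X)
    (I : set R) (g : X * R -> R) (t : R) :
  I t -> {within D `*` I, continuous g} -> {within D, continuous (fun x => g (x, t))}.
Proof.
move=> It /subspace_continuousP cg; apply/subspace_continuousP => x Dx.
apply: cvg_trans (cg (x, t) (conj Dx It)) => P; rewrite /within/=.
move=> [[V W] /= [nV nW] VW]; apply: filterS nV => y Vy Dy.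
by apply: (VW (y, t)) => //=; split=> //=; exact: nbhs_singleton.
Qed.

Lemma within_continuous_snd (R : realType) (X : topologicalType) (D : set X)
    (I : set R) (g : R -> R) :
  {within I, continuous g} -> {within D `*` I, continuous (fun p : X * R => g p.2)}.
Proof.
move=> /subspace_continuousP cg; apply/subspace_continuousP => -[x t] [/= Dx It].
apply: cvg_trans (cg _ It) => P; rewrite /within/= /from_subspace/= => nP.
exists (setT, fun y => I y -> P (g y)) => /=; first by split=> //; exact: filterT.
by move=> [y s] [_ /= H] [_ Is]; exact: H.
Qed.

(** * Comparison on the closed cylinder and evaluation at time [T] *)

Theorem lemma4p4 (R : realType) (n : nat) (hn : (1 <= n)%N)
    (U : set 'rV[R]_n) (U_neq0 : U !=set0) (U_open : open U)
    (U_bounded : bounded_set U)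
    (T : R) (T_gt0 : 0 < T)
    (A : 'rV[R]_n * R -> 'M[R]_n) (b : 'rV[R]_n * R -> 'rV[R]_n)
    (A_sym : forall p, (U `*` `]0, T]) p -> (A p)^T = A p)
    (c0 M1 M2 : R) (c0_gt0 : 0 < c0) (M1_gt0 : 0 < M1) (M2_ge0 : 0 <= M2)
    (A_ell : forall p, (U `*` `]0, T]) p -> forall xi : 'rV[R]_n,
      c0 * enorm xi ^+ 2 <= (xi *m A p *m xi^T) 0 0)
    (A_tr : forall p, (U `*` `]0, T]) p -> \tr (A p) <= M1)
    (b_bound : forall p, (U `*` `]0, T]) p -> enorm (b p) <= M2)
    (x0 : 'rV[R]_n) (x0_notin : ~ closure U x0) :
  let r0 := r_star U x0 in
  let R0 := R_star U x0 in
  let beta_star := (M1 + M2 * R0) / (2 * c0) in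
  let beta := Num.max beta_star (R0 ^+ 2 / (4 * c0 * T)) in
  let eta_star := 1 - (r0 / R0) `^ (2 * beta) in
  4 * c0 * beta_star * T = R0 ^+ 2 ->
  forall w : 'rV[R]_n * R -> R,
  {within closure U `*` `[0, T], continuous w} ->
  C21 U `]0, T] w ->
  forall F : R -> R,
  {within `[0, T], continuous F} ->
  (forall t, t \in `[0, T] -> 0 <= F t) ->
  (forall p, (U `*` `]0, T]) p -> Ltilde `]0, T] A b w p <= F p.2) ->
  max_on (closure U) (fun x => pospart w (x, T)) <=
    eta_star * max_on (closure U) (fun x => pospart w (x, 0))
    + max_on (boundary U `*` `[0, T]) (pospart w)
    + \int[lebesgue_measure]_(t in `[0, T]) F t.
Proof.
move=> r0 R0 beta_star beta eta_star hT w cw w21 F cF F_ge0 Lw.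
have cU := closure_bounded_compact _ _ _ U_bounded.
have cU0 : closure U !=set0 by case: U_neq0 => x Ux; exists x; exact: subset_closure.
have cenorm : {within closure U, continuous (fun x => enorm (x - x0))}.
  by apply: continuous_subspaceT => x; exact: enorm_continuous.
have [[xr Uxr r0E] r0_min] := min_onP cU0 cU cenorm.
have [_ R0_max] := max_onP cU0 cU cenorm.
rewrite -/(r_star U x0) -/r0 in r0E r0_min.
rewrite -/(R_star U x0) -/R0 in R0_max.
have r0_gt0 : 0 < r0.
  rewrite lt_def -r0E enorm_ge0 andbT; apply/eqP => e0.
  have := enormE (xr - x0); rewrite e0 expr0n/= => /esym/dotv_eq0/subr0_eq xE.
  by apply: x0_notin; rewrite -xE.
have r0R0 : r0 <= R0 by rewrite -[leLHS]r0E; exact: R0_max.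
have R0_gt0 : 0 < R0 := lt_le_trans r0_gt0 r0R0.
have bs_gt0 : 0 < beta_star.
  by rewrite divr_gt0 ?mulr_gt0// ltr_wpDr// mulr_ge0// ltW.
have betaE : beta = beta_star.
  rewrite /beta -hT (_ : _ / _ = beta_star) ?maxxx//.
  by field; rewrite !gt_eqF.
(* Exactly the time at which [heat_barrier_ratio] evaluates the barrier. *)
have TE : T = R0 ^+ 2 / (4 * c0 * beta_star) by rewrite -hT; field; rewrite !gt_eqF.
pose a := r0 ^+ 2 / (4 * c0).
have c4_gt0 : 0 < 4 * c0 by rewrite mulr_gt0.
have a_gt0 : 0 < a by rewrite divr_gt0 ?exprn_gt0.
pose q (x : 'rV[R]_n) := dotv (x - x0) (x - x0) / (4 * c0).
have a_le x : closure U x -> a <= q x.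
  move=> Ux; rewrite /a /q ler_pM2r ?invr_gt0// -enormE ler_sqr ?nnegrE ?enorm_ge0 ?(ltW r0_gt0)//.
  exact: r0_min.
pose phi x t := heat_barrier beta_star (q x) t.
pose K := heat_barrier_max beta_star a.
have K_gt0 : 0 < K by exact: expR_gt0.
have phi_le x t : closure U x -> 0 < t -> phi x t <= K.
  move=> Ux t0; have aq := a_le _ Ux.
  apply: (le_trans (heat_barrier_le _ _ _ bs_gt0 (lt_le_trans a_gt0 aq) t0)).
  exact: heat_barrier_max_le.
have T0I : `[0, T]%classic (0 : R) by rewrite /= in_itv/= lexx ltW.
have TTI : `[0, T]%classic T by rewrite /= in_itv/= lexx ltW.
have cpw := pospart_within_continuous _ _ _ _ cw.
have [_ M0_max] := max_onP cU0 cU (within_continuous_slice _ _ _ _ _ _ T0I cpw).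
have [[xT UxT wTE] _] := max_onP cU0 cU (within_continuous_slice _ _ _ _ _ _ TTI cpw).
rewrite -wTE.
set M0 := max_on _ (fun x => pospart w (x, 0)) in M0_max *.
have pos_ge0 p : 0 <= pospart w p by rewrite le_max lexx.
have pos_ge p : w p <= pospart w p by rewrite le_max lexx orbT.
have M0_ge0 : 0 <= M0 by apply: le_trans (M0_max _ Uxr); exact: pos_ge0.
have bU : boundary U `<=` closure U by move=> x [].
have cbT : compact (boundary U `*` `[0, T]).
  apply: compact_setX; last exact: segment_compact.
  apply: subclosed_compact cU bU.
  rewrite /boundary setDE; apply: closedI; first exact: closed_closure.
  by rewrite closedC; exact: open_interior.
have [xb bxb] := boundary_neq0 _ _ _ hn U_neq0 U_bounded.
have bT0 : boundary U `*` `[0, T] !=set0 by exists (xb, 0); split.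
have cpwb : {within boundary U `*` `[0, T], continuous (pospart w)}.
  by apply: continuous_subspaceW cpw => -[y s] [/= /bU].
have [_ N_max] := max_onP bT0 cbT cpwb.
set N := max_on _ (pospart w) in N_max *.
have N_ge0 : 0 <= N by apply: le_trans (N_max (xb, 0) _); first exact: pos_ge0.
pose G s := parameterized_integral lebesgue_measure 0 s F.
rewrite -/(parameterized_integral lebesgue_measure 0 T F) -/(G T).
have G_ge0 s : s \in `[0, T] -> 0 <= G s.
  rewrite in_itv/= => /andP[s0 sT]; apply: Rintegral_ge0 => r /=.
  rewrite in_itv/= => /andP[r_ge0 rs]; apply: F_ge0.
  by rewrite in_itv/= r_ge0 (le_trans rs).
have G0 : G 0 = 0 by rewrite /G /parameterized_integral set_itv1 Rintegral_set1.
have cG : {within `[0, T], continuous G}.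
  apply: parameterized_integral_continuous; first exact: ltW.
  by apply: continuous_compact_integrable => //; exact: segment_compact.
pose m := M0 / K.
have m_ge0 : 0 <= m by rewrite divr_ge0// ltW.
have bound y s : closure U y -> s \in `[0, T] ->
    w (y, s) + m * phi y s - G s <= M0 + N.
  move=> Uy sT; apply/ler_addgt0Pr => e e_gt0.
  (* With this slope the strictness term costs at most [e] over [[0, T]]. *)
  pose e' := e / T; have e'_gt0 : 0 < e' by rewrite divr_gt0.
  pose V (p : 'rV[R]_n * R) := w p + m * phi p.1 p.2 - G p.2 - e' * p.2.
  have cD : compact (closure U `*` `[0, T]).
    by apply: compact_setX => //; exact: segment_compact.
  have cV : {within closure U `*` `[0, T], continuous V}.
    have cphi : {within closure U `*` `[0, T], continuous (fun p => phi p.1 p.2)}.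
      apply: (heat_barrier_continuous _ _ _ _ _ _ _ bs_gt0 a_gt0 a_le) => x.
      exact: (cvgM (dotv_continuous x0 x) (cvg_cst _)).
    have cG' := within_continuous_snd _ _ (closure U) _ _ cG.
    have ce' : {within closure U `*` `[0, T], continuous (fun p => e' * p.2)}.
      apply: (within_continuous_snd _ _ _ _ (fun s => e' * s)).
      apply: continuous_subspaceT => r.
      exact: (cvgM (cvg_cst e') cvg_id).
    move=> p.
    exact: (cvgB (cvgB (cvgD (cw p) (cvgM (cvg_cst m) (cphi p))) (cG' p)) (ce' p)).
  have D0 : closure U `*` `[0, T] !=set0 by exists (y, s).
  have [[x t] /set_mem[/= Ux tT] Vmax] := compact_EVT_max D0 cD cV.
  have {}Vmax z r : closure U z -> r \in `[0, T] -> V (z, r) <= V (x, t).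
    by move=> Uz rT; apply: Vmax; apply/mem_set.
  have Vle : V (x, t) <= M0 + N.
    (* At [t = 0] the barrier vanishes and [w <= M0]; inside [U] a maximum is impossible; on the
       lateral boundary [w <= N], while [m = M0 / K] gives [m * phi <= M0]. *)
    have := tT; rewrite in_itv/= => /andP[]; rewrite le_eqVlt => /predU1P[t0E _|t_gt0 t_le].
      rewrite /V -t0E/= /phi heat_barrier0 ?gt_eqF// G0 !mulr0 addr0 !subr0.
      by rewrite -[leLHS]addr0 lerD// (le_trans (pos_ge _))// M0_max.
    have [xU|xnU] := pselect (U x).
      exfalso; apply: (heat_barrier_no_interior_max _ _ U T A b c0 M1 M2 R0 m e' x0 x t w F) => //.
      - by rewrite t_gt0.
      - by apply: A_sym; split=> //=; rewrite in_itv/= t_gt0.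
      - by apply: A_ell; split=> //=; rewrite in_itv/= t_gt0.
      - by apply: A_tr; split=> //=; rewrite in_itv/= t_gt0.
      - by apply: b_bound; split=> //=; rewrite in_itv/= t_gt0.
      - exact: R0_max.
      - by apply: (Lw (x, t)); split=> //=; rewrite in_itv/= t_gt0.
      - move=> z r Uz /andP[r0' rt]; apply: (Vmax z r); first exact: subset_closure.
        by rewrite in_itv/= ltW//= (le_trans rt).
    have bx : boundary U x by split=> //; have /interior_id -> := U_open.
    have h1 : w (x, t) <= N by rewrite (le_trans (pos_ge _))// N_max.
    have h2 : m * phi x t <= M0.
      by rewrite -[leRHS](divfK (lt0r_neq0 K_gt0)) ler_wpM2l// phi_le.
    have h3 := G_ge0 _ tT.
    have h4 : 0 <= e' * t by rewrite mulr_ge0// ltW.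
    rewrite /V/=; lra.
  have := le_trans (Vmax _ _ Uy sT) Vle; rewrite /V/= => Vys.
  have : e' * s <= e.
    rewrite /e' mulrAC ler_pdivrMr// ler_pM2l//.
    by move: sT; rewrite in_itv/= => /andP[].
  lra.
have ratio_ge0 : 0 <= (r0 / R0) `^ (2 * beta) by exact: powR_ge0.
have ratio_le1 : (r0 / R0) `^ (2 * beta) <= 1.
  rewrite [leRHS](_ : 1 = 1 `^ (2 * beta)); last by rewrite powR1.
  apply: ge0_ler_powR.
  - by rewrite mulr_ge0// betaE ltW.
  - by rewrite nnegrE divr_ge0// ltW.
  - by rewrite nnegrE.
  - by rewrite ler_pdivrMr// mul1r.
have GT_ge0 := G_ge0 _ TTI.
(* Where the positive part is [0], the right-hand side only has to be nonnegative; this uses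
   [eta_star >= 0], that is, [r0 <= R0]. *)
rewrite ge_max; apply/andP; split.
  by rewrite !addr_ge0// mulr_ge0// subr_ge0.
have := bound _ _ UxT TTI.
have : M0 * (r0 / R0) `^ (2 * beta) <= m * phi xT T.
  have -> : M0 * (r0 / R0) `^ (2 * beta) = m * ((r0 / R0) `^ (2 * beta) * K).
    by rewrite /m; field; rewrite gt_eqF.
  rewrite ler_wpM2l// {1}betaE /phi TE; apply: heat_barrier_ratio => //.
  rewrite -enormE ler_sqr ?nnegrE ?enorm_ge0 ?(ltW R0_gt0)//.
  exact: R0_max.
rewrite /eta_star; lra.
Qed.
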